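(* Let $n\ge 1$ be an integer and let $G$ be a group that acts by isometries on a $1$-hyperbolic space with minimal displacement greater than $100\log_2((n+1)!)$. If the field $\mathbb K$ is finite and the group $G$ is finitely generated, then the group $\mathrm{GL}_n(\mathbb K[G])$ is finitely generated.
   Context: Distances in a metric space are written $|p-q|$, and the Gromov product is $\langle p,q\rangle_r=\tfrac12(|p-r|+|q-r|-|p-q|)$. A $\delta$-hyperbolic space ($\delta\ge 0$) is a nonempty geodesic metric space such that (i) $\langle p,q\rangle_r\ge\min(\langle p,s\rangle_r,\langle s,q\rangle_r)-\delta$ for all points $p,q,r,s$; and (ii) all geodesic triangles are $\delta$-thin: if $p(t),q(t)$ are arc length parametrizations, starting at $r$, of geodesics $[r,p]$ and $[r,q]$, then $|p(t)-q(t)|\le\delta$ for $0\le t\le\langle p,q\rangle_r$. The minimal displacement of an isometric action of $G$ on $\mathcal H$ is $\inf_{g\in G\setminus\{1\},\,p\in\mathcal H}|g\cdot p-p|$. $\mathbb K[G]$ is the group algebra. *)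

(* Defs.v *)
From HB Require Import structures.
From mathcomp Require Import all_boot all_order all_algebra finmap.
From mathcomp Require Import all_classical all_reals.
From mathcomp Require Import ereal topology exp.
(* The notations of monalg cannot be loaded together with those of
   mathcomp-analysis. *)
From mathcomp Require Import -(notations) monalg.

Set Implicit Arguments.
Unset Strict Implicit.
Unset Printing Implicit Defensive.

Import Order.TTheory GRing.Theory Num.Theory.

Local Open Scope classical_set_scope.
Local Open Scope ring_scope.

Section MetricGeometry.
Context {R : realType} {H : metricType R}.
Implicit Types (p q r s : H) (c : R -> H) (delta t u : R).

Definition gromov_product p q r : R :=
  (mdist p r + mdist q r - mdist p q) / 2.

(* Only the values of c on [0, mdist r p] are relevant. *)
Definition geodesic_param r p c : Prop :=
  [/\ c 0 = r, c (mdist r p) = p &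
      forall t u, 0 <= t <= mdist r p -> 0 <= u <= mdist r p ->
        mdist (c t) (c u) = `|t - u|].

Definition four_point_condition delta : Prop :=
  forall p q r s,
    gromov_product p q r >=
      Num.min (gromov_product p s r) (gromov_product s q r) - delta.

Definition thin_triangles delta : Prop :=
  forall r p q c c', geodesic_param r p c -> geodesic_param r q c' ->
    forall t, 0 <= t <= gromov_product p q r -> mdist (c t) (c' t) <= delta.

End MetricGeometry.

Definition geodesic_space {R : realType} (H : metricType R) : Prop :=
  forall p q : H, exists c : R -> H, geodesic_param p q c.

Definition hyperbolic_space {R : realType} (delta : R) (H : metricType R) :
    Prop :=
  0 <= delta /\
  [/\ inhabited H, geodesic_space H,
      @four_point_condition R H delta & @thin_triangles R H delta].

Section IsometricActions.
Context {R : realType} {G : groupType} {H : metricType R}.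
Implicit Types (act : G -> H -> H).

Definition isometric_action act : Prop :=
  [/\ forall p, act 1%g p = p,
      forall g h p, act (g * h)%g p = act g (act h p) &
      forall g p q, mdist (act g p) (act g q) = mdist p q].

(* The infimum is taken in the extended reals: it is +oo for trivial G. *)
Definition minimal_displacement act : \bar R :=
  ereal_inf [set (mdist (act g p) p)%:E |
              g in [set g : G | g != 1%g] & p in [set: H]].

End IsometricActions.

Definition log2 {R : realType} (x : R) : R := ln x / ln 2.

Definition finitely_generated (G : groupType) : Prop :=
  exists s : seq G, forall S : {pred G},
    group_closed S -> {subset s <= S} -> forall g, g \in S.

(* The ring structure on malg G K in monalg requires that 1 be the only
   invertible element of G; only its module structure is reused here. *)
Definition group_algebra (K : nzRingType) (G : groupType) : Type := malg G K.

Section GroupAlgebra.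
Context (K : nzRingType) (G : groupType).

HB.instance Definition _ := GRing.Lmodule.copy (group_algebra K G) (malg G K).

Local Notation KG := (group_algebra K G).
Local Notation U := (@mkmalgU G K).
Implicit Types (a b c : KG) (g h k : G) (x y : K).

Definition ga_one : KG := U 1%g 1.

Definition ga_mul a b : KG :=
  \sum_(g <- msupp a) \sum_(h <- msupp b)
    U (g * h)%g (mcoeff g a * mcoeff h b).

Lemma ga_mulw (d e : {fset G}) a b :
  (msupp a `<=` d)%fset -> (msupp b `<=` e)%fset ->
  ga_mul a b = \sum_(g <- d) \sum_(h <- e)
    U (g * h)%g (mcoeff g a * mcoeff h b).
Proof.
move=> ad be; rewrite /ga_mul (big_fset_incl _ ad) /=.
  apply: eq_bigr => g _; apply: (big_fset_incl _ be) => h _ /mcoeff_outdom ->.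
  by rewrite mulr0 monalgU0.
move=> g _ /mcoeff_outdom ga.
by rewrite big1 // => h _; rewrite ga mul0r monalgU0.
Qed.

Lemma ga_mulDl : left_distributive ga_mul +%R.
Proof.
move=> a b c.
rewrite (ga_mulw (msuppD_le a b) (fsubset_refl (msupp c))).
rewrite (ga_mulw (fsubsetUl (msupp a) (msupp b)) (fsubset_refl (msupp c))).
rewrite (ga_mulw (fsubsetUr (msupp a) (msupp b)) (fsubset_refl (msupp c))).
rewrite -big_split; apply: eq_bigr => g _.
rewrite -big_split; apply: eq_bigr => h _ /=.
by rewrite mcoeffD mulrDl monalgUD.
Qed.

Lemma ga_mulDr : right_distributive ga_mul +%R.
Proof.
move=> c a b.
rewrite (ga_mulw (fsubset_refl (msupp c)) (msuppD_le a b)).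
rewrite (ga_mulw (fsubset_refl (msupp c)) (fsubsetUl (msupp a) (msupp b))).
rewrite (ga_mulw (fsubset_refl (msupp c)) (fsubsetUr (msupp a) (msupp b))).
rewrite -big_split; apply: eq_bigr => g _.
rewrite -big_split; apply: eq_bigr => h _ /=.
by rewrite mcoeffD mulrDr monalgUD.
Qed.

Lemma ga_mul0l : left_zero 0 ga_mul.
Proof. by move=> a; rewrite /ga_mul msupp0 big_seq_fset0. Qed.

Lemma ga_mul0r : right_zero 0 ga_mul.
Proof.
by move=> a; rewrite /ga_mul big1 // => g _; rewrite msupp0 big_seq_fset0.
Qed.

Lemma ga_mulUU g h x y : ga_mul (U g x) (U h y) = U (g * h)%g (x * y).
Proof. by rewrite (ga_mulw msuppU_le msuppU_le) !big_seq_fset1 !mcoeffUU. Qed.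

Lemma ga_mul_suml I (s : seq I) (F : I -> KG) b :
  ga_mul (\sum_(i <- s) F i) b = \sum_(i <- s) ga_mul (F i) b.
Proof.
by apply: (big_morph (ga_mul^~ b)) => [x y|]; rewrite ?ga_mulDl ?ga_mul0l.
Qed.

Lemma ga_mul_sumr I (s : seq I) (F : I -> KG) b :
  ga_mul b (\sum_(i <- s) F i) = \sum_(i <- s) ga_mul b (F i).
Proof.
by apply: (big_morph (ga_mul b)) => [x y|]; rewrite ?ga_mulDr ?ga_mul0r.
Qed.

Lemma ga_mulA : associative ga_mul.
Proof.
move=> a b c; rewrite (monalgE a) !(ga_mul_suml (msupp a)).
apply: eq_bigr => g _; rewrite (monalgE b) (ga_mul_sumr (msupp b)).
rewrite !(ga_mul_suml (msupp b)) (ga_mul_sumr (msupp b)).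
apply: eq_bigr => h _; rewrite (monalgE c) !(ga_mul_sumr (msupp c)).
by apply: eq_bigr => k _; rewrite !ga_mulUU mulrA mulgA.
Qed.

Lemma ga_mul1 : left_id ga_one ga_mul.
Proof.
move=> a; rewrite [in LHS](monalgE a) ga_mul_sumr [RHS]monalgE.
by apply: eq_bigr => g _; rewrite ga_mulUU mul1r mul1g.
Qed.

Lemma ga_mulr1 : right_id ga_one ga_mul.
Proof.
move=> a; rewrite [in LHS](monalgE a) ga_mul_suml [RHS]monalgE.
by apply: eq_bigr => g _; rewrite ga_mulUU mulr1 mulg1.
Qed.

Lemma ga_one_neq0 : ga_one != 0.
Proof. by rewrite /ga_one monalgU_eq0 oner_neq0. Qed.

HB.instance Definition _ := GRing.Zmodule_isNzRing.Build (group_algebra K G)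
  ga_mulA ga_mul1 ga_mulr1 ga_mulDl ga_mulDr ga_one_neq0.

End GroupAlgebra.

Section GeneralLinearGroup.
Context (n : nat) (A : nzRingType).

(* unitmx is only available over commutative rings. *)
Definition invertible_mx (M : 'M[A]_n) : Prop :=
  exists N : 'M[A]_n, M *m N = 1%:M /\ N *m M = 1%:M.

Record GL : Type := MkGL { GL_val :> 'M[A]_n; _ : `[< invertible_mx GL_val >] }.

HB.instance Definition _ := [isSub for GL_val].
HB.instance Definition _ := [Choice of GL by <:].

Lemma GL_invertible (M : GL) : invertible_mx M.
Proof. exact: (asboolW (valP M)). Qed.

Lemma invertible_mx1 : invertible_mx 1%:M.
Proof. by exists 1%:M; rewrite mulmx1. Qed.

Lemma invertible_mxM (M N : GL) : invertible_mx (M *m N).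
Proof.
have [M' [MM' M'M]] := GL_invertible M; have [N' [NN' N'N]] := GL_invertible N.
exists (N' *m M'); split.
  by rewrite mulmxA -(mulmxA _ (N : 'M_n)) NN' mulmx1.
by rewrite mulmxA -(mulmxA _ M') M'M mulmx1.
Qed.

Definition GL_inv_val (M : GL) : 'M[A]_n := sval (cid (GL_invertible M)).

Lemma GL_mulmxV (M : GL) : M *m GL_inv_val M = 1%:M.
Proof. by rewrite /GL_inv_val; case: cid => N []. Qed.

Lemma GL_mulVmx (M : GL) : GL_inv_val M *m M = 1%:M.
Proof. by rewrite /GL_inv_val; case: cid => N []. Qed.

Lemma invertible_mxV (M : GL) : invertible_mx (GL_inv_val M).
Proof. by exists M; rewrite GL_mulmxV GL_mulVmx. Qed.

Definition GL_one : GL := MkGL (asboolT invertible_mx1).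
Definition GL_mul (M N : GL) : GL := MkGL (asboolT (invertible_mxM M N)).
Definition GL_inv (M : GL) : GL := MkGL (asboolT (invertible_mxV M)).

Lemma GL_mulA : associative GL_mul.
Proof. by move=> M N P; apply: val_inj; exact: mulmxA. Qed.

Lemma GL_mul1g : left_id GL_one GL_mul.
Proof. by move=> M; apply: val_inj; exact: mul1mx. Qed.

Lemma GL_mulg1 : right_id GL_one GL_mul.
Proof. by move=> M; apply: val_inj; exact: mulmx1. Qed.

Lemma GL_mulVg : left_inverse GL_one GL_inv GL_mul.
Proof. by move=> M; apply: val_inj; exact: GL_mulVmx. Qed.

Lemma GL_mulgV : right_inverse GL_one GL_inv GL_mul.
Proof. by move=> M; apply: val_inj; exact: GL_mulmxV. Qed.

HB.instance Definition _ := isGroup.Build GL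
  GL_mulA GL_mul1g GL_mulg1 GL_mulVg GL_mulgV.

End GeneralLinearGroup.

(* Main.v *)
Require Import Defs.
From HB Require Import structures.
From mathcomp Require Import all_boot all_order all_algebra finmap.
From mathcomp Require Import all_classical all_reals.
From mathcomp Require Import ereal topology exp.
From mathcomp Require Import -(notations) monalg.
From mathcomp Require Import lra zify.

(** The proof is a Euclidean algorithm for columns over K[G].  Fix an orbit map
    g |-> g p0; the size of x is the diameter [diam x] of the image of its
    support.  Left translation preserves it.

    Let sum_i y_i x_i = 0 be a nontrivial relation.  Its terms are the
    translates g x_i with g in the support of y_i, and every point of the union
    of their supports must be cancelled.  Look at the union from a base point
    and call a point high if its distance to the base point exceeds some
    threshold.  Terms that share high points are linked.  In a tree, take a
    linked family and, in it, the term e = g x_i whose support, regarded as a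
    ball, reaches farthest past the base point.  The sum of the family has no
    high points, because no other term contributes to the high points of the
    family; and the points that are left lie in a ball of smaller radius than
    that of e, centred closer to the base point.  If no other translate of x_i
    is in the family, this sum is, up to a unit, the result of adding to x_i a
    combination of the other x_j, and its diameter is smaller than that of
    x_i.

    In a hyperbolic space three things need care.
    - Linked families may be long, and Gromov products deteriorate along a
      chain.  The loss is only logarithmic in the length ([chained_gp]), and
      the terms of a chain whose balls reach farthest past the base point, its
      hubs, are few: two translates of the same x_i that are close in the chain
      have close centres, which the displacement forbids, so there are at most
      n hubs.  Between hubs the terms are smaller, and induction applies
      ([drift]).
    - No other translate of x_i may be in the family; this is again forbidden
      by the displacement ([comp_label_unique]).
    - The chosen term must reach well above the threshold.  The thresholds of
      a ladder with n steps are tried; if the choice changed at every step, two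
      of the chosen terms would be translates of the same x_i
      ([exists_reducible_family]).
    Each hub argument costs a logarithm of n and there are n steps, so the
    displacement needed is of the order n log n, as is the logarithm of
    (n + 1)! ([le_log2_fact]).

    Applied to products y v, the same construction shows that K[G] has no zero
    divisors ([ga_mul_eq0]) and that its units are monomials
    ([right_inv_mono]).  If M is invertible, the rows of its inverse are
    relations for the columns of M, so that M can be row reduced to the
    identity ([row_equiv1]): GL_n(K[G]) is generated by elementary matrices and
    by diagonal matrices with monomial entries.  Conjugating an elementary
    matrix by a diagonal one multiplies its entry by a group element, hence the
    elementary matrices with entry in K and the diagonal matrices with entries
    in K or among generators of G suffice. *)

Set Implicit Arguments.
Unset Strict Implicit.
Unset Printing Implicit Defensive.

Import Order.TTheory GRing.Theory Num.Theory.

Local Open Scope ring_scope.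

(** * Four points in a hyperbolic space *)

Section FourPoints.
Context {R : realType} {H : metricType R}.
Hypothesis four : @four_point_condition R H 1.
Hypothesis geod : geodesic_space H.
Implicit Types (p q x y z w b : H) (t : R).

(** The four-point condition without Gromov products, the form that linear
    arithmetic can use. *)
Lemma four_point_exchange x y z w :
  mdist x y + mdist z w <= mdist x z + mdist y w + 2 \/
  mdist x y + mdist z w <= mdist x w + mdist y z + 2.
Proof.
have := four x y w z; rewrite /gromov_product.
rewrite (metric_sym z y) (metric_sym z w) => h.
have [h1|h1] := leP ((mdist x w + mdist w z - mdist x z) / 2)
          ((mdist w z + mdist y w - mdist y z) / 2).
  left; move: h; rewrite (min_idPl _); lra.
right; move: h; rewrite (min_idPr _); lra.
Qed.

Lemma exists_geodesic_point p q t : 0 <= t <= mdist p q ->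
  exists m : H, mdist p m = t /\ mdist m q = mdist p q - t.
Proof.
move=> /andP[t0 tpq]; have [c [c0 cd cD]] := geod p q.
exists (c t); split.
  by rewrite -{1}c0 cD ?lexx ?t0 ?tpq ?mdist_ge0 // distrC subr0 ger0_norm.
rewrite -{1}cd cD ?lexx ?t0 ?tpq ?mdist_ge0 //.
by rewrite distrC ger0_norm ?subr_ge0.
Qed.

(** With the next lemma: a set of diameter 2 rho is, up to the error 2, as good
    as the ball of radius rho about the midpoint of a diameter.  It is contained
    in that ball, and from any point b it is seen to extend as far. *)
Lemma midpoint_dist_le p q (m : H) (rho : R) w :
  mdist p q = 2 * rho -> mdist p m = rho -> mdist m q = rho ->
  mdist w p <= 2 * rho -> mdist w q <= 2 * rho -> mdist w m <= rho + 2.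
Proof.
move=> pq pm mq wp wq; have := four_point_exchange w m p q.
rewrite (metric_sym m p); lra.
Qed.

Lemma dist_le_midpoint_far p q (m : H) (rho : R) b :
  mdist p q = 2 * rho -> mdist p m = rho -> mdist m q = rho ->
  mdist m b + rho - 2 <= mdist p b \/ mdist m b + rho - 2 <= mdist q b.
Proof.
move=> pq pm mq; have := four_point_exchange m b p q.
rewrite (metric_sym m p) (metric_sym b q) (metric_sym b p); lra.
Qed.

Section Based.
Variable b : H.
Let gp x y := gromov_product x y b.

Lemma gromov_product_ultra (m : R) x y z : m <= gp x y -> m <= gp y z -> m - 1 <= gp x z.
Proof.
move=> xy yz; apply: le_trans (four x z b y).
by rewrite lerD2r le_min xy yz.
Qed.

Lemma gromov_productC x y : gp x y = gp y x.
Proof. by rewrite /gp /gromov_product (metric_sym x y) [X in X - _]addrC. Qed.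

Lemma gromov_product_ultra3 (m : R) x y z w :
  m <= gp x y -> m <= gp y z -> m <= gp z w -> m - 2 <= gp x w.
Proof.
move=> xy yz zw; have -> : m - 2 = m - 1 - 1 by lra.
apply: (gromov_product_ultra (gromov_product_ultra xy yz)).
by apply: le_trans zw; lra.
Qed.

Definition chained (m : R) x y N := exists ws : seq H,
  [/\ path (fun u v => m <= gp u v) x ws, last x ws = y & (0 < size ws <= N)%N].

Lemma chained1 m x y N : (0 < N)%N -> m <= gp x y -> chained m x y N.
Proof. by move=> N0 xy; exists [:: y]; rewrite /= xy. Qed.

Lemma chained_cons m x y z N : m <= gp x y -> chained m y z N -> chained m x z N.+1.
Proof.
move=> xy [ws [p l /andP[_ s]]]; exists (y :: ws); split => //=.
by rewrite xy.
Qed.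

Lemma chained_le m x y N N' : (N <= N')%N -> chained m x y N -> chained m x y N'.
Proof.
by move=> NN [ws [p l /andP[s0 s]]]; exists ws; rewrite s0 (leq_trans s NN).
Qed.

(** Cutting the chain in two halves loses 1 once for both halves, so the loss is
    the logarithm of the length and not the length itself. *)
Lemma chained_gp m x y k : chained m x y (2 ^ k) -> m - k%:R <= gp x y.
Proof.
elim: k x y => [|k IH] x y [ws [pw lw /andP[s0 s]]].
  by case: ws s0 s pw lw => [|z []] //= _ _; rewrite andbT subr0 => ? <-.
have [sk|sk] := leqP (size ws) (2 ^ k).
  have : m - k%:R <= gp x y by apply: IH; exists ws; rewrite s0.
  by apply: le_trans; rewrite lerD2l lerN2 ler_nat.
move: pw lw; rewrite -{1 2}(cat_take_drop (2 ^ k) ws) cat_path last_cat.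
move=> /andP[p1 p2] lw; rewrite -natr1 opprD addrA.
apply: (@gromov_product_ultra _ _ (last x (take (2 ^ k) ws))); apply: IH.
  by exists (take (2 ^ k) ws); rewrite size_takel ?expn_gt0 ?leqnn // ltnW.
exists (drop (2 ^ k) ws); split => //; rewrite size_drop subn_gt0 sk leq_subLR.
by rewrite addnn -mul2n -expnS.
Qed.


(** * Linked families of sets *)

(** The sets [X f] are round up to the error 2, with centre [c f] and radius
    [r f].  Seen from [b], the ball of [f] has its centre at distance [d f], it
    reaches up to [d f + r f], and past [b] it reaches as far as [s f], which
    may be negative.  Sets with the same label are meant to be translates of
    each other; [D] is the minimal displacement. *)
Section Terms.
Variables (n k : nat) (T : finType) (lab : T -> 'I_n) (c : T -> H) (r : T -> R).
Variables (X : T -> set H) (D L : R).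
Let d f := mdist (c f) b.
Let s f := r f - d f.
Hypothesis Xball : forall f w, X f w -> mdist w (c f) <= r f + 2.
Hypothesis Xfar : forall f, exists2 w, X f w & d f + r f - 2 <= mdist w b.
Hypothesis labP : forall f g, lab f = lab g -> f <> g ->
  r f = r g /\ D < mdist (c f) (c g).
Hypothesis drL : forall f, d f + r f <= L.
Hypothesis nk : (2 * n + 2 <= 2 ^ k)%N.

Let k_gt0 : (0 < k)%N.
Proof. by move: nk; case: k => //; rewrite expn0 addn2. Qed.

Section Level.
Variable h : R.
Let high w := h < mdist w b.

Definition adj : rel T := fun f g => `[< exists w, [/\ X f w, X g w & high w] >].

Lemma adj_sym f g : adj f g = adj g f.
Proof. by apply/asboolP/asboolP => -[w [? ? ?]]; exists w. Qed.

Lemma connect_adj_sym : connect_sym adj.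
Proof. exact/sym_connect_sym/adj_sym. Qed.

Lemma dist_le_reach f w : X f w -> mdist w b <= d f + r f + 2.
Proof.
move=> /Xball wf; have := metric_triangle w (c f) b.
rewrite -/(d f); lra.
Qed.

Lemma top_point f w : X f w -> high w ->
  exists t : H, [/\ X f t, high t & d f - 2 <= gp (c f) t].
Proof.
move=> fw hw; have [z fz dz] := Xfar f.
have key (t : H) : X f t -> d f + r f - 2 <= mdist t b -> d f - 2 <= gp (c f) t.
  move=> /Xball ft dt; rewrite /gp /gromov_product -/(d f).
  rewrite (metric_sym (c f) t); lra.
have [zw|wz] := leP (mdist z b) (mdist w b).
  by exists w; split => //; apply: key => //; apply: le_trans zw.
by exists z; split => //; [apply: lt_trans wz | apply: key].
Qed.

(** Two high points of a set whose geodesics from [b] part early are far apart,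
    which takes a ball that reaches far past [b]. *)
Lemma gp_common f w w' : X f w -> X f w' -> high w -> high w' ->
  (h - s f) / 2 - 2 <= gp w w'.
Proof.
move=> fw fw' hw hw'; rewrite /gp /gromov_product /s.
have := four_point_exchange w w' (c f) b; rewrite (metric_sym w' (c f)).
have := Xball fw; have := Xball fw'; rewrite (metric_sym w' (c f)).
move: hw hw'; rewrite /high -/(d f); lra.
Qed.

Hypothesis DL : L - h + 4 * k%:R + 8 <= D.

(** Each centre is near the geodesic from [b] to the top point of its set, and
    these geodesics stay close for long; as the radii are equal, the depths of
    the centres differ by little more than the spread [L - h] of the levels.
    So the centres are closer than the displacement. *)
Lemma same_label_eq f g (M : R) (t u : H) : lab f = lab g ->
  M - 2 * k%:R <= s f -> s g <= M ->
  X f t -> high t -> d f - 2 <= gp (c f) t ->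
  X g u -> high u -> d g - 2 <= gp (c g) u ->
  (h - M) / 2 - 2 - k%:R <= gp t u -> f = g.
Proof.
move=> fg sf sg ft ht tf gu hu ug tu; apply/eqP/negPn/negP => /eqP fNg.
have [rfg Dfg] := labP fg fNg.
have k1 : (1 : R) <= k%:R by rewrite ler1n.
have df := dist_le_reach ft; have dg := dist_le_reach gu.
have Lf := drL f; have Lg := drL g.
pose m := Num.min (Num.min (d f - 2) ((h - M) / 2 - 2 - k%:R)) (d g - 2).
have : m - 2 <= gp (c f) (c g).
  apply: (@gromov_product_ultra3 _ _ t u); last rewrite gromov_productC.
  - by apply: le_trans tf; rewrite /m !ge_min lexx ?orbT.
  - by apply: le_trans tu; rewrite /m !ge_min lexx ?orbT.
  - by apply: le_trans ug; rewrite /m !ge_min lexx ?orbT.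
rewrite /gp /gromov_product -/(d f) -/(d g) => mfg.
move: sf sg; rewrite /s => sf sg; move: ht hu; rewrite /high => ht hu.
have : m = d f - 2 \/ m = (h - M) / 2 - 2 - k%:R \/ m = d g - 2.
  rewrite /m; case: (leP (d f - 2)) => _; case: leP => _; tauto.
clear fg; move: (m) mfg => m' mfg; rewrite rfg in df dg Lf Lg sf sg *.
by move: DL => DL0; case=> [m1|[m1|m1]]; lra.
Qed.

(** The bound to be proved on the Gromov products along paths, by induction on
    [M].  Up to the error 2, [(h - M) / 2] is the least distance from [b] at
    which two high points of a single set with [s <= M] can part, by
    [gp_common]. *)
Definition drift_bounded (M : R) := forall f (p : seq T) w w',
  path adj f p -> all (fun g => s g <= M) (f :: p) ->
  X f w -> X (last f p) w' -> high w -> high w' ->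
  (h - M) / 2 - (2 + k%:R) <= gp w w'.

(** The hubs of a path are the sets whose reach past [b] is within [2 * k] of the
    maximum [M].  For the other sets the induction hypothesis is better by [k],
    which pays for one chain of [2 ^ k] steps. *)
Section DriftStep.
Variable M : R.
Hypothesis IH : drift_bounded (M - 2 * k%:R).
Let small g := s g <= M.
Let hub g := M - 2 * k%:R < s g.
Let mu := (h - M) / 2 - 2.

Definition reached_by_nonhubs v f := exists g (p : seq T),
  [/\ path adj g p, last g p = f, all (predC hub) (g :: p), X g v & high v].

Lemma reached_gp v f w : reached_by_nonhubs v f -> X f w -> high w ->
  mu <= gp v w.
Proof.
move=> [g [p [gp_ <- nh gv hv]]] fw hw.
have := IH gp_ _ gv fw hv hw; rewrite /mu.
have -> : all (fun g0 => s g0 <= M - 2 * k%:R) (g :: p).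
  by apply: sub_all nh => x; rewrite /= /hub -leNgt.
move=> /(_ isT); lra.
Qed.

Lemma gp_small f w w' : small f -> X f w -> X f w' -> high w -> high w' ->
  mu <= gp w w'.
Proof.
move=> sf fw fw' hw hw'; apply: le_trans (gp_common fw fw' hw hw').
by move: sf; rewrite /small /mu; lra.
Qed.

(** Crossing a hub is one step by [gp_common], and so is crossing a stretch
    without hubs, however long, by the induction hypothesis. *)
Lemma chained_path f (p : seq T) : path adj f p -> all small (f :: p) ->
  forall v w, X (last f p) w -> high w ->
  (hub f -> X f v -> high v -> chained mu v w (2 * count hub (f :: p))) /\
  (~~ hub f -> reached_by_nonhubs v f ->
     chained mu v w (2 * count hub (f :: p)).+1).
Proof.
elim: p f => [|g p IHp] f /=.
  move=> _ /andP[sf _] v w fw hw; split=> [hf fv hv|hf nv]; last first.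
    by apply: chained1 => //; apply: reached_gp nv fw hw.
  by rewrite hf; apply: chained1 => //; apply: gp_small sf fv fw hv hw.
move=> /andP[/asboolP[a [fa ga ha]] gp_] /andP[sf sp] v w lw hw.
have [IH1 IH2] := IHp g gp_ sp a w lw hw.
have [_ IH3] := IHp g gp_ sp v w lw hw.
split=> [hf fv hv|hf nv].
  apply: (@chained_le _ _ _ (2 * (hub g + count hub p)).+2).
    by rewrite hf (mulnDr 2 1).
  apply: (chained_cons (gp_small sf fv fa hv ha)).
  have [hg|hg] := boolP (hub g).
    by apply: chained_le (IH1 hg ga ha); rewrite /= hg.
  apply: chained_le (IH2 hg _); first by rewrite /= (negbTE hg).
  by exists g, [::]; rewrite /= hg.
rewrite (negbTE hf) add0n.
have [hg|hg] := boolP (hub g).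
  apply: (chained_cons (reached_gp nv fa ha)).
  by apply: chained_le (IH1 hg ga ha); rewrite /= hg.
apply: chained_le (IH3 hg _); first by rewrite /= (negbTE hg).
have [g0 [p0 [gp0 l0 nh gv hv]]] := nv.
exists g0, (rcons p0 g); split => //; rewrite ?last_rcons //.
  by rewrite rcons_path gp0 l0; apply/asboolP; exists a.
by rewrite -rcons_cons all_rcons /= hg.
Qed.

Lemma count_labels_le (l : seq T) : uniq (map lab l) -> (size l <= n)%N.
Proof.
move=> /card_uniqP; rewrite size_map => <-.
by rewrite -[n in leqRHS]card_ord max_card.
Qed.

(** At the first repetition of a label, the hubs before it have distinct labels,
    so that there are at most [n] of them; the path between the two hubs of the
    same label then amounts to a chain of at most [2 * n + 2 <= 2 ^ k] steps,
    and [same_label_eq] applies. *)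
Lemma hub_labels_uniq f (p : seq T) : path adj f p -> all small (f :: p) ->
  uniq (f :: p) -> uniq (map lab [seq x <- f :: p | hub x]).
Proof.
elim/last_ind: p => [|p g IHp]; first by rewrite /=; case: ifP.
rewrite rcons_path -rcons_cons all_rcons rcons_uniq filter_rcons.
move=> /andP[fp ag] /andP[sg sp] /andP[gNp up].
have {IHp} IHp := IHp fp sp up; case: ifP => // hg.
rewrite map_rcons rcons_uniq IHp andbT; apply/negP => /mapP[x].
rewrite mem_filter => /andP[hx xp] gx.
have cnt := count_labels_le IHp; rewrite size_filter in cnt.
have [p1 [p2 E]] : exists (p1 p2 : seq T), f :: p = p1 ++ x :: p2.
  by case/splitPr: xp => p1 p2; exists p1, p2.
have xg : path adj x (rcons p2 g).
  have : path adj f (rcons p g) by rewrite rcons_path fp.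
  case: p1 E => [[<- <-] //|y p1 [_ ->]].
  by rewrite rcons_cat cat_path /= => /and3P[].
have sxg : all small (x :: rcons p2 g).
  rewrite -rcons_cons all_rcons sg /=.
  by move: sp; rewrite E all_cat => /andP[].
have [w [xw hw]] : exists w, X x w /\ high w.
  case: p2 {E sxg} xg => [|y p2] /= /andP[/asboolP[w [xw yw hw]] _];
  by exists w.
have [w' [gw' hw']] : exists w, X g w /\ high w.
  by case/asboolP: ag => v [_ gv hv]; exists v.
have [t [xt ht tx]] := top_point xw hw.
have [u [gu hu ug]] := top_point gw' hw'.
have lu : X (last x (rcons p2 g)) u by rewrite last_rcons.
have [ch _] := chained_path xg sxg t lu hu.
have {}ch := ch hx xt ht.
have tu : mu - k%:R <= gp t u.
  apply: chained_gp; apply: chained_le ch; apply: leq_trans nk.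
  rewrite -rcons_cons -cats1 count_cat /= hg addn0 mulnDr muln1 leq_add2r leq_mul2l.
  by apply: leq_trans cnt; rewrite E count_cat leq_addl.
have xE : x = g.
  apply: (same_label_eq (esym gx) _ sg xt ht tx gu hu ug tu); exact: ltW.
by move: gNp; rewrite -xE xp.
Qed.

Lemma drift_step : drift_bounded M.
Proof.
move=> f p w w' fp sp fw lw hw hw'.
move: lw sp; case/shortenP: fp => q fq uq sub lw sp.
have {}sp : all small (f :: q).
  move: sp => /= /andP[sf /allP sp]; apply/andP; split=> //.
  by apply/allP => x /sub /sp.
have cnt := count_labels_le (hub_labels_uniq fq sp uq).
rewrite size_filter in cnt.
have [c1 c2] := chained_path fq sp w lw hw'.
rewrite opprD addrA; apply: chained_gp.
have [hf|hf] := boolP (hub f).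
  apply: chained_le (c1 hf fw hw); apply: leq_trans nk.
  by apply: leq_trans (leq_addr _ _); rewrite leq_mul2l.
apply: chained_le (c2 hf _); last by exists f, [::]; rewrite /= hf.
by apply: leq_trans nk; rewrite addn2 ltnS leqW // leq_mul2l.
Qed.
End DriftStep.

(** Paths have no bounded length, but below all values of [s] there are no paths,
    and every step of the induction raises [M] by [2 * k]. *)
Lemma drift (M : R) : drift_bounded M.
Proof.
have [B Bs] : exists B : R, forall f, B < s f.
  exists (- (1 + \sum_f `|s f|)) => f.
  have : - `|s f| <= s f by rewrite lerNl -normrN ler_norm.
  apply: lt_le_trans; rewrite ltrN2 (bigD1 f) //=.
  have : 0 <= \sum_(i | i != f) `|s i| by apply: sumr_ge0.
  lra.
have k1 : (1 : R) <= k%:R by rewrite ler1n.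
have [N MN] : exists N : nat, M <= B + N%:R.
  exists (Num.bound `|M - B|); rewrite -lerBlDl.
  apply: le_trans (ler_norm _) _; exact: ltW (archi_boundP (normr_ge0 _)).
elim: N M MN => [|N IHN] M MN.
  move=> f p w w' _ /= /andP[sf _]; have := Bs f; move: MN; rewrite addr0; lra.
by apply: drift_step => //; apply: IHN; move: MN; rewrite -natr1; lra.
Qed.

Section Component.
Variable e0 : T.
Let comp f := connect adj e0 f.
Hypothesis high0 : exists2 w, X e0 w & high w.

Lemma comp_high f : comp f -> exists2 w, X f w & high w.
Proof.
move=> /connectP[p pp ->]; case/lastP: p pp => [//|p g].
rewrite rcons_path last_rcons => /andP[_ /asboolP[w [_ gw hw]]].
by exists w.
Qed.

Variable e : T.
Hypothesis e_comp : comp e.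
Hypothesis e_max : forall f, comp f -> s f <= s e.

Lemma comp_drift f (w w' : H) : comp f -> X e w -> X f w' -> high w -> high w' ->
  (h - s e) / 2 - (2 + k%:R) <= gp w w'.
Proof.
move=> cf ew fw hw hw'.
have /connectP[p ep fE] : connect adj e f.
  by apply: connect_trans cf; rewrite connect_adj_sym.
rewrite fE in fw; apply: (drift ep _ ew fw hw hw').
apply/allP => g gp_; apply: e_max; apply: connect_trans e_comp _.
exact: (path_connect ep gp_).
Qed.

Lemma comp_label_unique f : comp f -> lab f = lab e -> f = e.
Proof.
move=> cf fe; have [w ew hw] := comp_high e_comp.
have [v fv hv] := comp_high cf.
have [t [et ht te]] := top_point ew hw.
have [u [fu hu uf]] := top_point fv hv.
apply: esym.
apply: (same_label_eq (esym fe) _ (e_max cf) et ht te fu hu uf).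
  by rewrite lerBlDr lerDl mulr_ge0.
have := comp_drift cf et fu ht hu; lra.
Qed.

(** The new centre [c'] is found by moving [c e] towards [b].  A point [w] of the
    component that is not high is closer to [b] than [e] reaches, and it is not
    much farther from [c e] than [r e], since [s] is maximal at [e]; moving
    towards [b] therefore decreases the radius needed. *)
Lemma comp_low_points : h + (2 * k%:R + 16) <= d e + r e ->
  exists c' : H, forall f w, comp f -> X f w -> ~~ high w -> mdist w c' <= r e - 1.
Proof.
move=> eh.
(* The distance from [c e] exceeds [r e] by at most [2 * k + 10]; 3 more pay for
   one use of hyperbolicity and for the gain. *)
have [t tE] : exists t : R, t = 2 * k%:R + 13 by exists (2 * k%:R + 13).
have k1 : (1 : R) <= k%:R by rewrite ler1n.
have [dt|td] := ltP (d e) t.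
  by exists b => f w _ _; rewrite -leNgt => wh; lra.
have t0 : 0 <= t by lra.
have [c' [ct cb]] : exists m : H, mdist (c e) m = t /\ mdist m b = d e - t.
  by apply: exists_geodesic_point; rewrite ?t0.
exists c' => f w cf fw; rewrite -leNgt => wh.
have wc : mdist w (c e) <= r e + t - 3.
  have [v ev hv] := comp_high e_comp.
  have [v' fv hv'] := comp_high cf.
  have [x [ex hx xe]] := top_point ev hv.
  have [y [fy hy yf]] := top_point fv hv'.
  have drxy := comp_drift cf ex fy hx hy.
  have sf := e_max cf; have wf := Xball fw.
  have yb := dist_le_reach fy; rewrite /high in hy.
  have [ex1|ex2] := four_point_exchange w (c e) (c f) b.
    move: ex1 sf; rewrite /s -/(d f) -/(d e); lra.
  pose m := Num.min (Num.min (d e - 2) ((h - s e) / 2 - (2 + k%:R))) (d f - 2).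
  have : m - 2 <= gp (c e) (c f).
    apply: (@gromov_product_ultra3 _ _ x y); last rewrite gromov_productC.
    - by apply: le_trans xe; rewrite /m !ge_min lexx ?orbT.
    - by apply: le_trans drxy; rewrite /m !ge_min lexx ?orbT.
    - by apply: le_trans yf; rewrite /m !ge_min lexx ?orbT.
  have : m = d e - 2 \/ m = (h - s e) / 2 - (2 + k%:R) \/ m = d f - 2.
    rewrite /m; case: (leP (d e - 2)) => _; case: leP => _; tauto.
  move: (m) => m' mE; rewrite /gp /gromov_product -/(d e) -/(d f) => mef.
  move: ex2 sf mE; rewrite /s -/(d e) -/(d f) => ex2 sf.
  by case=> [mE|[mE|mE]]; lra.
have := four_point_exchange w c' (c e) b.
rewrite (metric_sym c' (c e)) ct cb -/(d e); lra.
Qed.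
End Component.
End Level.

Lemma adj_le h h' f g : h' <= h -> adj h f g -> adj h' f g.
Proof.
by move=> hh /asboolP[w [fw gw hw]]; apply/asboolP; exists w; split=> //; lra.
Qed.

(** The threshold is lowered in [n] steps from just below the level reached by
    [e0].  The component of [e0] grows, and so does the maximum of [s] on it.
    Were it to grow at every step, two of the [n + 1] sets attaining it would
    have the same label.  When it stalls, the set [e] attaining it already had
    points above the previous threshold, so it reaches well above the next. *)
Theorem exists_reducible_family (e0 : T) : d e0 + r e0 = L ->
  n%:R * (2 * k%:R + 18) + 4 * k%:R + 11 <= D ->
  exists h e (S : pred T) (c' : H),
  [/\ S e,
      forall f g w, S f -> X f w -> X g w -> h < mdist w b -> S g,
      forall f, S f -> lab f = lab e -> f = e &
      forall f w, S f -> X f w -> mdist w b <= h -> mdist w c' <= r e - 1].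
Proof.
move=> e0L nD.
(* [e0] has a point at level at least [L - 2], by [Xfar]. *)
pose h m : R := L - 3 - m%:R * (2 * k%:R + 18).
have k0 : (0 : R) <= k%:R by [].
have h_le m m' : (m <= m')%N -> h m' <= h m.
  by move=> mm; rewrite /h lerD2l lerN2 ler_pM2r ?ler_nat //; lra.
have hD m : (m <= n)%N -> L - h m + 4 * k%:R + 8 <= D.
  move=> mn; apply: le_trans nD; have := h_le m n mn; rewrite /h; lra.
have high0 m : exists2 w, X e0 w & h m < mdist w b.
  have [w w0 dw] := Xfar e0; exists w => //; apply: lt_le_trans dw.
  by rewrite e0L; apply: le_lt_trans (h_le 0%N m _) _; rewrite // /h; lra.
pose e m := [arg max_(f > e0 | connect (adj (h m)) e0 f) s f]%O.
have e_comp m : connect (adj (h m)) e0 (e m).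
  by rewrite /e; case: arg_maxP.
have e_max m f : connect (adj (h m)) e0 f -> s f <= s (e m).
  by rewrite /e; case: arg_maxP => // i _ imax /imax.
have comp_le m m' f : (m <= m')%N ->
  connect (adj (h m)) e0 f -> connect (adj (h m')) e0 f.
  move=> mm; apply: connect_sub => x y xy; apply/connect1.
  exact: adj_le (h_le _ _ mm) xy.
have [m sm] : exists m : 'I_n, s (e m.+1) <= s (e m).
  apply: contrapT => /forallNP sm.
  have s_lt m m' : (m < m')%N -> (m' <= n)%N -> s (e m) < s (e m').
    elim: m' => // m' IH; rewrite ltnS leq_eqVlt => /orP[/eqP<-|mm] mn.
      by rewrite ltNge; apply/negP; apply: (sm (Ordinal mn)).
    apply: lt_trans (IH mm (ltnW mn)) _.
    by rewrite ltNge; apply/negP; apply: (sm (Ordinal mn)).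
  have lab_lt (a a' : 'I_n.+1) : (a < a')%N -> lab (e a) = lab (e a') -> False.
    move=> aa ll; have an : (a' <= n)%N by rewrite -ltnS.
    have := s_lt _ _ aa an.
    rewrite (comp_label_unique (hD _ an) (high0 a') (e_comp a') (@e_max a') _ ll).
      by rewrite ltxx.
    exact: comp_le (ltnW aa) (e_comp a).
  have : injective (fun a : 'I_n.+1 => lab (e a)).
    move=> a a' ll; apply/val_inj; case: (ltngtP a a') => //= aa.
      by case: (lab_lt _ _ aa).
    by case: (lab_lt _ _ aa).
  by move=> /leq_card; rewrite !card_ord ltnn.
have mn : (m.+1 <= n)%N by [].
have em_comp : connect (adj (h m.+1)) e0 (e m).
  exact: comp_le (leqnSn m) (e_comp m).
have em_max f : connect (adj (h m.+1)) e0 f -> s f <= s (e m).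
  by move=> /e_max /le_trans; apply.
have gap : h m.+1 + (2 * k%:R + 16) <= d (e m) + r (e m).
  have [w ew hw] := comp_high (high0 m) (e_comp m).
  have := dist_le_reach ew; move: hw; rewrite /h -natr1; lra.
have [c' low] := comp_low_points (hD _ mn) (high0 m.+1) em_comp em_max gap.
exists (h m.+1), (e m), (connect (adj (h m.+1)) e0), c'; split => //.
- move=> f g w Sf fw gw hw; apply: connect_trans Sf _; apply: connect1.
  by apply/asboolP; exists w.
- by move=> f Sf fe; apply: (comp_label_unique (hD _ mn) (high0 m.+1) em_comp em_max).
- by move=> f w Sf fw hw; apply: low Sf fw _; rewrite -leNgt.
Qed.
End Terms.
End Based.
End FourPoints.

(** * The displacement needed *)

(** Pairing opposite factors, [(i + 1) * (m - i) >= m]. *)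
Lemma expnn_le_fact_sqr m : (m ^ m <= m`! ^ 2)%N.
Proof.
have E : (m`! = \prod_(i < m) i.+1)%N.
  by rewrite fact_prod big_add1 /= big_mkord.
rewrite -mulnn {1}E E [X in (_ * X)%N](reindex_inj rev_ord_inj) /= -big_split /=.
rewrite -[m in X in (X <= _)%N]card_ord -prod_nat_const card_ord.
by apply: leq_prod => i _; have := ltn_ord i; nia.
Qed.

Lemma exp2_le_fact n : (2 ^ n <= n.+1`!)%N.
Proof.
elim: n => // n IH; rewrite expnS factS; exact: leq_mul.
Qed.

(** Half of the exponent 100 is spent through
    [(n + 1)! ^ 2 >= (n + 1) ^ (n + 1)], which bounds the terms in [n * k], and
    the other half through [(n + 1)! >= 2 ^ n]. *)
Lemma displacement_budget n k :
  (0 < n)%N -> (2 <= k)%N -> (2 ^ (k - 2) <= n.+1)%N ->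
  (2 ^ (n * (2 * k + 18) + 4 * k + 11) <= n.+1`! ^ 100)%N.
Proof.
move=> n0 k2 kn.
apply: (@leq_trans (2 ^ (25 * (k - 2) * n.+1 + 50 * n))).
  by rewrite leq_exp2l //; nia.
rewrite expnD (expnD _ 50 50) leq_mul //.
  apply: (@leq_trans ((n.+1 ^ n.+1) ^ 25)).
    by rewrite -expnM (mulnC 25) -mulnA (mulnC 25) expnM leq_exp2r // muln_gt0.
  by rewrite (expnM _ 2 25) leq_exp2r // expnn_le_fact_sqr.
by rewrite mulnC expnM leq_exp2r // exp2_le_fact.
Qed.

Lemma le_log2_fact (R : realType) n k : (0 < n)%N -> (2 <= k)%N ->
  (2 ^ (k - 2) <= n.+1)%N ->
  n%:R * (2 * k%:R + 18) + 4 * k%:R + 11 <= 100 * log2 (n.+1`!)%:R :> R.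
Proof.
move=> n0 k2 kn; have := displacement_budget n0 k2 kn.
have l2 : 0 < ln 2 :> R by rewrite ln_gt0 // ltr1n.
rewrite -(ler_nat R) !natrX => le2.
have : ln (2 ^+ (n * (2 * k + 18) + 4 * k + 11)) <= ln ((n.+1`!)%:R ^+ 100 : R).
  by rewrite ler_ln ?posrE ?exprn_gt0 ?ltr0n ?fact_gt0.
rewrite !lnXn ?ltr0n ?fact_gt0 //.
rewrite -[X in X <= _ -> _]mulr_natl -[X in _ <= X -> _]mulr_natl -ler_pdivlMr //.
by rewrite -mulrA /log2 !(natrD, natrM).
Qed.

Lemma exists_dyadic_bound n : (0 < n)%N ->
  exists k, [/\ (2 <= k)%N, (2 ^ (k - 2) <= n.+1)%N & (2 * n + 2 <= 2 ^ k)%N].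
Proof.
move=> n0; exists (trunc_log 2 n.+1).+2; rewrite !subSS subn0 trunc_logP //.
split=> //; have := @trunc_log_ltn 2 n.+1 isT.
rewrite (expnS 2 (trunc_log 2 n.+1).+1) => /ltnW; lia.
Qed.

(** * Supports in the group algebra *)

Section Monomials.
Context {K : nzRingType} {G : groupType}.
Local Notation KG := (group_algebra K G).
Implicit Types (x y z : KG) (g h w : G) (a : K).

Definition mono g a : KG := @mkmalgU G K g a.

Lemma ga_coeff_sum I (r : seq I) (P : pred I) (F : I -> KG) w :
  mcoeff w (\sum_(i <- r | P i) F i) = \sum_(i <- r | P i) mcoeff w (F i).
Proof.
by apply: (big_morph (fun x : KG => mcoeff w x)) => [x y|];
  rewrite ?mcoeffD ?mcoeff0.
Qed.

Lemma ga_expand x : x = \sum_(g <- msupp x) mono g (mcoeff g x).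
Proof. exact: monalgE. Qed.

Lemma ga_coeff_monoM g a x w :
  mcoeff w (mono g a * x) = a * mcoeff (g^-1 * w)%g x.
Proof.
have -> : mono g a * x = \sum_(h <- msupp x) mono (g * h)%g (a * mcoeff h x).
  rewrite {1}(ga_expand x) mulr_sumr; apply: eq_bigr => h _.
  exact: ga_mulUU.
rewrite ga_coeff_sum [in RHS](ga_expand x) ga_coeff_sum mulr_sumr.
apply: eq_bigr => h _; rewrite !mcoeffU.
rewrite (can2_eq (mulKg g) (mulVKg g)).
by rewrite mulrnAr.
Qed.

Lemma monoM g h a b : mono g a * mono h b = mono (g * h)%g (a * b).
Proof. exact: ga_mulUU. Qed.

Lemma ga_neq0 x : x != 0 -> exists g, g \in msupp x.
Proof.
move=> x0; apply/fset0Pn; apply: contraNneq x0 => E.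
by rewrite (ga_expand x) E big_seq_fset0.
Qed.

End Monomials.

Lemma big_unique_seq (V : nmodType) (I : eqType) (s : seq I) (P : pred I) e
    (F : I -> V) : uniq s -> e \in s -> P e ->
  (forall f, f \in s -> P f -> f = e) -> \sum_(f <- s | P f) F f = F e.
Proof.
move=> us es Pe uP; rewrite big_mkcond (bigD1_seq e) //= Pe big1_seq ?addr0 //.
by move=> f /andP[fe fs]; case: ifP => // Pf; rewrite (uP f) ?eqxx // in fe.
Qed.

Section Displacement.
Context {R : realType} {H : metricType R} {G : groupType}.
Variables (act : G -> H -> H).
Hypothesis hact : isometric_action act.
Hypothesis hH : hyperbolic_space 1 H.
Variable K : fieldType.
Local Notation KG := (group_algebra K G).
Implicit Types (x y z : KG) (g h w : G) (a : K).
Variable p0 : H.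
Let pt g := act g p0.

Definition diam x : R :=
  \big[Num.max/0]_(p : msupp x * msupp x) mdist (pt (val p.1)) (pt (val p.2)).

Lemma dist_le_diam x g h : g \in msupp x -> h \in msupp x ->
  mdist (pt g) (pt h) <= diam x.
Proof.
move=> gx hx; rewrite /diam.
exact: (le_bigmax _ _ ([` gx], [` hx])%fset).
Qed.

Lemma diam_le x (m : R) : 0 <= m ->
  (forall g h, g \in msupp x -> h \in msupp x -> mdist (pt g) (pt h) <= m) ->
  diam x <= m.
Proof.
by move=> m0 gh; apply/bigmax_leP; split => // p _; apply: gh; apply: valP.
Qed.

Lemma diam_attained x : x != 0 ->
  exists g h, [/\ g \in msupp x, h \in msupp x & mdist (pt g) (pt h) = diam x].
Proof.
move=> /ga_neq0[g gx].
pose F (p : msupp x * msupp x) := mdist (pt (val p.1)) (pt (val p.2)).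
pose p := [arg max_(p > ([` gx], [` gx])%fset) F p]%O.
exists (val p.1), (val p.2); split; try exact: valP.
apply/le_anti; rewrite dist_le_diam ?valP //=; apply/bigmax_leP.
split=> [|q _]; first exact: mdist_ge0.
by rewrite -/(F q) -/(F p) /p; case: arg_maxP => // i _; apply.
Qed.

Lemma act_dist g p q : mdist (act g p) (act g q) = mdist p q.
Proof. by case: hact. Qed.

Lemma actM g h p : act (g * h)%g p = act g (act h p).
Proof. by case: hact. Qed.

Lemma support_center x : x != 0 -> exists m : H,
  (forall g, g \in msupp x -> mdist (pt g) m <= diam x / 2 + 2) /\
  (forall b, exists2 g, g \in msupp x &
     mdist m b + diam x / 2 - 2 <= mdist (pt g) b).
Proof.
move=> x0; have [_ [_ geod four _]] := hH.
have [g [h [gx hx gh]]] := diam_attained x0.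
have rE : mdist (pt g) (pt h) = 2 * (diam x / 2) by lra.
have d0 : 0 <= diam x by rewrite -gh mdist_ge0.
have dd : 0 <= diam x / 2 <= mdist (pt g) (pt h) by apply/andP; split; lra.
have [m [gm mh]] := exists_geodesic_point geod dd.
have {}mh : mdist m (pt h) = diam x / 2 by lra.
exists m; split=> [w wx|b].
  apply: (midpoint_dist_le four rE gm mh); rewrite -rE gh; exact: dist_le_diam.
by case: (dist_le_midpoint_far four b rE gm mh) => ?; [exists g | exists h].
Qed.

Lemma mono_supp_dist g a x (m : H) (rho : R) :
  (forall h, h \in msupp x -> mdist (pt h) m <= rho) ->
  forall w, w \in msupp (mono g a * x) -> mdist (pt w) (act g m) <= rho.
Proof.
move=> xm w; rewrite -mcoeff_neq0 ga_coeff_monoM => aw.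
rewrite -(mulVKg g w) /pt actM act_dist; apply: xm.
by rewrite -mcoeff_neq0; apply: contraNneq aw => ->; rewrite mulr0.
Qed.

Lemma mono_supp_far g a x (m b : H) (rho : R) : a != 0 ->
  (forall b, exists2 h, h \in msupp x & mdist m b + rho <= mdist (pt h) b) ->
  exists2 w, w \in msupp (mono g a * x) &
    mdist (act g m) b + rho <= mdist (pt w) b.
Proof.
have actVK p : act g (act g^-1%g p) = p.
  by rewrite -actM mulgV; case: hact.
move=> a0 /(_ (act g^-1%g b))[h hx hb]; exists (g * h)%g.
  by rewrite -mcoeff_neq0 ga_coeff_monoM mulKg mulf_neq0 // mcoeff_neq0.
by rewrite -{1}(actVK b) -{2}(actVK b) /pt actM !act_dist.
Qed.

(** The orbit map turns left multiplication into isometries; this is why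
    relations are written with the coefficients on the left. *)
Lemma diam_monoM g a x : a != 0 -> diam (mono g a * x) = diam x.
Proof.
have sub h c y : diam (mono h c * y) <= diam y.
  apply: diam_le => [|u v]; first by apply/bigmax_geP; left.
  rewrite -!mcoeff_neq0 !ga_coeff_monoM => au av.
  rewrite -(mulVKg h u) -(mulVKg h v) /pt !(actM h) act_dist.
  apply: dist_le_diam; rewrite -mcoeff_neq0.
    by apply: contraNneq au => ->; rewrite mulr0.
  by apply: contraNneq av => ->; rewrite mulr0.
move=> a0; apply/le_anti; rewrite sub /=.
have {1}-> : x = mono g^-1%g a^-1 * (mono g a * x).
  by rewrite mulrA monoM mulVg mulVf // mul1r.
exact: sub.
Qed.

Section Truncation.
Variables (n k : nat) (D : R).
Hypothesis nk : (2 * n + 2 <= 2 ^ k)%N.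
Hypothesis budget : n%:R * (2 * k%:R + 18) + 4 * k%:R + 11 <= D.
Hypothesis displ : forall g p, g != 1%g -> D < mdist (act g p) p.

Variables (x : 'I_n -> KG) (s : seq (G * 'I_n)) (a : G * 'I_n -> K) (b : H).
Hypothesis s_nonnil : s != [::].
Hypothesis s_neq0 : forall f, f \in s -> (a f != 0) && (x f.2 != 0).
Let term f := mono f.1 (a f) * x f.2.

(** The terms of a sum, with [y] the partial sum over a linked family.  At its
    far points [y] agrees with the whole sum, and its other points lie in a
    ball that is too small for [x e.2].  Moreover [x e.2] enters [y] through one
    term only. *)
Theorem shrinking_truncation : exists (h : R) (e : G * 'I_n) (S : pred (G * 'I_n)) (c : H),
  let y := \sum_(f <- s | S f) term f in
  [/\ e \in s /\ S e, (forall f, f \in s -> S f -> f.2 = e.2 -> f = e),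
      forall f w, f \in s -> S f -> w \in msupp (term f) ->
        h < mdist (pt w) b ->
        mcoeff w y = mcoeff w (\sum_(f <- s) term f) &
      forall f w, f \in s -> S f -> w \in msupp (term f) ->
        mdist (pt w) b <= h -> mdist (pt w) c <= diam (x e.2) / 2 - 1].
Proof.
have [_ [_ geod four _]] := hH.
have ctrP i : exists m : H, x i != 0 ->
  (forall g, g \in msupp (x i) -> mdist (pt g) m <= diam (x i) / 2 + 2) /\
  (forall b, exists2 g, g \in msupp (x i) &
     mdist m b + (diam (x i) / 2 - 2) <= mdist (pt g) b).
  have [xi|xi] := eqVneq (x i) 0; first by exists p0.
  have [m [m1 m2]] := support_center xi; exists m => _; split=> // b0.
  by have [g gx gb] := m2 b0; exists g => //; rewrite addrA.
have [ctr ctrE] := choice ctrP.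
pose T : finType := seq_sub s.
pose c (t : T) := act (ssval t).1 (ctr (ssval t).2).
pose r (t : T) : R := diam (x (ssval t).2) / 2.
pose X (t : T) : set H :=
  fun p => exists2 w, w \in msupp (term (ssval t)) & p = pt w.
have t_neq0 (t : T) : (a (ssval t) != 0) && (x (ssval t).2 != 0).
  exact: s_neq0 (ssvalP t).
have Xball (t : T) p : X t p -> mdist p (c t) <= r t + 2.
  move=> [w wt ->]; have /andP[_ /ctrE[m1 _]] := t_neq0 t.
  exact: mono_supp_dist m1 _ wt.
have Xfar (t : T) : exists2 p, X t p & mdist (c t) b + r t - 2 <= mdist p b.
  have /andP[at0 /ctrE[_ m2]] := t_neq0 t.
  have [w wt wb] := mono_supp_far (ssval t).1 b at0 m2.
  by exists (pt w); [exists w | rewrite -addrA].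
have labP (t u : T) : (ssval t).2 = (ssval u).2 -> t <> u ->
    r t = r u /\ D < mdist (c t) (c u).
  move=> tu tNu; split; first by rewrite /r tu.
  have gN : ((ssval u).1^-1 * (ssval t).1)%g != 1%g.
    apply/eqP => E; have g1 : (ssval t).1 = (ssval u).1.
      by rewrite -(mulVKg (ssval u).1 (ssval t).1) E mulg1.
    apply: tNu; apply: val_inj => /=.
    by case: (ssval t) (ssval u) tu g1 => [? ?] [? ?] /= -> ->.
  have := displ (ctr (ssval u).2) gN.
  by rewrite -(act_dist (ssval u).1) -actM mulVKg /c tu.
have [f0 f0s] : exists f, f \in s.
  by case: (s) s_nonnil => // f s' _; exists f; rewrite mem_head.
pose t0 : T := SeqSub f0s.
pose F t := mdist (c t) b + r t.
pose e0 := [arg max_(t > t0) F t]%O.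
have FL t : F t <= F e0 by rewrite /e0; case: arg_maxP => // i _; apply.
have [h [e [S [c' [Se closed lab_uniq low]]]]] :=
  exists_reducible_family four geod Xball Xfar labP FL nk (erefl (F e0)) budget.
pose S' f := if insub f is Some t then S t else false.
have S'E (t : T) : S' (ssval t) = S t by rewrite /S' valK.
have inT f : f \in s -> exists t : T, f = ssval t by move=> fs; exists (SeqSub fs).
exists h, (ssval e), S', c' => /=; split.
- by rewrite S'E; split=> //; exact: ssvalP.
- move=> _ /inT[t ->]; rewrite S'E => St te.
  by rewrite (lab_uniq _ St te).
- move=> _ w /inT[t ->]; rewrite S'E => St wt wh.
  rewrite !ga_coeff_sum big_mkcond; apply: eq_big_seq => _ /inT[u ->].
  rewrite S'E; case: ifPn => // Su; apply/esym/eqP; rewrite mcoeff_eq0.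
  by apply: contra Su => wu; apply: (closed t u (pt w)) => //; exists w.
- by move=> _ w /inT[t ->]; rewrite S'E => St wt wh; apply: (low t) => //; exists w.
Qed.
End Truncation.

Lemma diam_le_ball x (c : H) (rho : R) : x != 0 ->
  (forall g, g \in msupp x -> mdist (pt g) c <= rho) -> diam x <= 2 * rho.
Proof.
move=> x0 xc; have [g [h [gx hx <-]]] := diam_attained x0.
have := metric_triangle (pt g) c (pt h); rewrite (metric_sym c).
have := xc _ gx; have := xc _ hx; lra.
Qed.

Section Consequences.
Variables (n k : nat) (D : R).
Hypothesis n_gt0 : (0 < n)%N.
Hypothesis nk : (2 * n + 2 <= 2 ^ k)%N.
Hypothesis budget : n%:R * (2 * k%:R + 18) + 4 * k%:R + 11 <= D.
Hypothesis displ : forall g p, g != 1%g -> D < mdist (act g p) p.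

Lemma monoM_neq0 g a x : a != 0 -> x != 0 -> mono g a * x != 0.
Proof.
move=> a0; apply: contraNneq => E.
have -> : x = mono g^-1%g a^-1 * (mono g a * x).
  by rewrite mulrA monoM mulVg mulVf // mul1r.
by rewrite E mulr0.
Qed.

(** With a single label, the family of [shrinking_truncation] consists of one
    translate of [v].  It has far points, as it does not fit into a ball that is
    too small for [v], and at these points the other translates do not
    contribute. *)
Lemma exists_uncancelled_translate (y v : KG) (b : H) : y != 0 -> v != 0 ->
  exists (h : R) g, g \in msupp y /\
    (forall w, w \in msupp (mono g (mcoeff g y) * v) ->
       h < mdist (pt w) b -> w \in msupp (y * v)) /\
    exists2 w, w \in msupp (mono g (mcoeff g y) * v) & h < mdist (pt w) b.
Proof.
move=> y0 v0; pose i0 := Ordinal n_gt0.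
pose s := [seq (g, i0) | g <- msupp y].
pose a (f : G * 'I_n) := mcoeff f.1 y.
have s0 : s != [::].
  have [g gy] := ga_neq0 y0.
  have : (g, i0) \in s by apply: map_f.
  by case: (s).
have sP f : f \in s -> (a f != 0) && (v != 0).
  by move=> /mapP[g gy ->]; rewrite v0 andbT /a /= mcoeff_neq0.
have yv : \sum_(f <- s) mono f.1 (a f) * v = y * v.
  by rewrite -mulr_suml /s big_map [in RHS](ga_expand y).
have [h [e [S [c [[es Se] uS hi lo]]]]] := shrinking_truncation nk budget displ b s0 sP.
have /mapP[g gy eE] := es; exists h, g; split => //.
have s_uniq : uniq s by rewrite map_inj_uniq ?fset_uniq // => ? ? [].
have trunc : \sum_(f <- s | S f) mono f.1 (a f) * v = mono g (mcoeff g y) * v.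
  rewrite (big_unique_seq _ s_uniq es Se) ?eE // => f fs Sf.
  rewrite -eE; apply: uS => //.
  by move: fs => /mapP[? _ ->]; rewrite eE.
rewrite eE in es Se; split=> [w wg wh|].
  have := hi (g, i0) w es Se wg wh; rewrite trunc yv -!mcoeff_neq0 => <-.
  by rewrite mcoeff_neq0.
apply: contrapT => nhigh.
have gv0 : mono g (mcoeff g y) * v != 0 by rewrite monoM_neq0 // mcoeff_neq0.
have /(diam_le_ball gv0) : forall w, w \in msupp (mono g (mcoeff g y) * v) ->
    mdist (pt w) c <= diam v / 2 - 1.
  move=> w wg; apply: (lo (g, i0) w) => //; rewrite leNgt.
  by apply/negP => wh; apply: nhigh; exists w.
by rewrite diam_monoM ?mcoeff_neq0 //; lra.
Qed.

Lemma ga_mul_eq0 (y v : KG) : y * v = 0 -> y = 0 \/ v = 0.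
Proof.
move=> yv; have [->|y0] := eqVneq y 0; first by left.
have [->|v0] := eqVneq v 0; first by right.
have [h [g [_ [hi [w wg wh]]]]] := exists_uncancelled_translate p0 y0 v0.
by have := hi w wg wh; rewrite yv -mcoeff_neq0 mcoeff0 eqxx.
Qed.

(** The support of [1] is at distance 0 from the base point [p0].  So the
    threshold for the uncancelled translate of [v] is negative, all its points
    are far, and its support is that of [1]. *)
Lemma right_inv_mono (y v : KG) : y * v = 1 ->
  exists g a, a != 0 /\ v = mono g a.
Proof.
move=> yv; have y0 : y != 0.
  by apply: contra_eq_neq yv => ->; rewrite mul0r eq_sym oner_neq0.
have v0 : v != 0.
  by apply: contra_eq_neq yv => ->; rewrite mulr0 eq_sym oner_neq0.
have [h [g [gy [hi [w wg wh]]]]] := exists_uncancelled_translate p0 y0 v0.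
have one1 u : u \in msupp (y * v) -> u = 1%g.
  by rewrite yv -mcoeff_neq0 mcoeffU; case: (1%g =P u) => [->|_] //; rewrite eqxx.
have h0 : h < 0.
  have := wh; rewrite (one1 w (hi w wg wh)) /pt.
  by have [-> _ _] := hact; rewrite mdistxx.
have supp1 u : u \in msupp (mono g (mcoeff g y) * v) -> u = 1%g.
  by move=> ug; apply/one1/hi => //; apply: lt_le_trans h0 (mdist_ge0 _ _).
exists g^-1%g, (mcoeff g^-1%g v).
have v1 u : u \in msupp v -> u = g^-1%g.
  move=> uv; have := supp1 (g * u)%g; rewrite -mcoeff_neq0 ga_coeff_monoM mulKg.
  rewrite mulf_neq0 ?mcoeff_neq0 // => /(_ isT) gu.
  by rewrite -[LHS](mulKg g) gu mulg1.
have [u uv] := ga_neq0 v0; split; first by rewrite mcoeff_neq0 -(v1 u uv).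
apply/malgP => z; rewrite mcoeffU; case: eqP => [<-|zg]; first by rewrite mulr1n.
by rewrite mulr0n; apply: mcoeff_outdom; apply/negP => /v1/esym.
Qed.

(** The step of the Euclidean algorithm: in the truncation of a vanishing sum the
    far points have cancelled, and what remains lies in a small ball. *)
Lemma vector_reduction (x y : 'I_n -> KG) : \sum_i y i * x i = 0 ->
  (exists2 i, y i != 0 & x i != 0) ->
  exists i g a (u : 'I_n -> KG), [/\ a != 0, x i != 0 &
    let x' := mono g a * x i + \sum_(j | j != i) u j * x j in
    x' = 0 \/ diam x' <= diam (x i) - 2].
Proof.
move=> yx [i0 yi0 xi0].
(* Terms with [x i = 0] have empty support and must be left out. *)
pose s := [seq (g, i) | i <- [seq i <- enum 'I_n | x i != 0], g <- msupp (y i)].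
pose a (f : G * 'I_n) := mcoeff f.1 (y f.2).
have sE g i : ((g, i) \in s) = (x i != 0) && (g \in msupp (y i)).
  apply/allpairsPdep/andP => [[i' [g' [+ gy [-> ->]]]]|[xi gy]].
    by rewrite mem_filter => /andP[].
  by exists i, g; rewrite mem_filter xi mem_enum.
have s_uniq : uniq s.
  apply: allpairs_uniq_dep; first by rewrite filter_uniq ?enum_uniq.
    by move=> i _; apply: fset_uniq.
  by move=> [? ?] [? ?] _ _ /= [-> ->].
have s0 : s != [::].
  have [g gy] := ga_neq0 yi0.
  have : (g, i0) \in s by rewrite sE xi0.
  by case: (s).
have sP f : f \in s -> (a f != 0) && (x f.2 != 0).
  by case: f => g i; rewrite sE /a /= mcoeff_neq0 andbC.
have zE : \sum_(f <- s) mono f.1 (a f) * x f.2 = 0.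
  rewrite /s big_allpairs_dep /= big_filter big_enum_cond -[RHS]yx.
  rewrite [in RHS](bigID (fun i => x i != 0)) /= [X in _ + X]big1 ?addr0.
    by apply: eq_bigr => i _; rewrite -mulr_suml -ga_expand.
  by move=> i /negPn/eqP ->; rewrite mulr0.
have [h [e [S [c [[es Se] uS hi lo]]]]] := shrinking_truncation nk budget displ p0 s0 sP.
pose u j := \sum_(f <- s | S f && (f.2 == j)) mono f.1 (a f).
have x'E : \sum_(f <- s | S f) mono f.1 (a f) * x f.2 =
    mono e.1 (a e) * x e.2 + \sum_(j | j != e.2) u j * x j.
  rewrite (partition_big snd xpredT) //= (bigD1 e.2) //=; congr (_ + _).
    apply: big_unique_seq => //; first by rewrite Se eqxx.
    by move=> f fs /andP[Sf /eqP fe]; apply: uS.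
  apply: eq_bigr => j _; rewrite mulr_suml; apply: eq_bigr => f.
  by move=> /andP[_ /eqP ->].
have /andP[ae xe] := sP e es.
exists e.2, e.1, (a e), u; rewrite -x'E; split=> //=.
set x' := \sum_(f <- s | S f) _ in hi lo *.
have [->|x'0] := eqVneq x' 0; [by left | right].
have /(diam_le_ball x'0) : forall w, w \in msupp x' ->
    mdist (pt w) c <= diam (x e.2) / 2 - 1.
  move=> w; rewrite -mcoeff_neq0 => wx'.
  have [f [fs Sf wf]] : exists f,
      [/\ f \in s, S f & w \in msupp (mono f.1 (a f) * x f.2)].
    apply: contrapT => /forallNP nf; move: wx'.
    rewrite /x' ga_coeff_sum big1_seq ?eqxx // => f /andP[Sf fs].
    by apply: mcoeff_outdom; apply/negP => wf; apply: (nf f).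
  apply: (lo f w) => //; rewrite leNgt; apply/negP => /(hi f w fs Sf wf) x'w.
  by move: wx'; rewrite x'w zE mcoeff0 eqxx.
lra.
Qed.
End Consequences.
End Displacement.

(** * Row reduction over a ring with a Euclidean step for vectors *)

Section RowReduction.
Variables (A : nzRingType) (n : nat).
Implicit Types (M N : 'M[A]_n) (i j k l : 'I_n) (a t : A).

Definition row_add i j a M : 'M[A]_n :=
  \matrix_(p, q) (if p == i then M p q + a * M j q else M p q).

Definition row_scale i t M : 'M[A]_n :=
  \matrix_(p, q) (if p == i then t * M p q else M p q).

Definition elem_mx i j a := row_add i j a 1%:M.
Definition dil_mx i t := row_scale i t 1%:M.

Lemma elem_mxM i j a M : elem_mx i j a *m M = row_add i j a M.
Proof.
apply/matrixP => p q; rewrite !mxE.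
transitivity (\sum_s ((p == s)%:R * M s q +
    (if p == i then a * ((j == s)%:R * M s q) else 0))).
  apply: eq_bigr => s _; rewrite !mxE; case: ifP => _; last by rewrite addr0.
  by rewrite mulrDl mulrA.
have sumd u : \sum_s (u == s)%:R * M s q = M u q.
  rewrite (bigD1 u) //= eqxx mul1r big1 ?addr0 // => s.
  by rewrite eq_sym => /negbTE ->; rewrite mul0r.
rewrite big_split /= sumd; case: ifP => _; last by rewrite big1 ?addr0.
by rewrite -mulr_sumr sumd.
Qed.

Lemma dil_mxM i t M : dil_mx i t *m M = row_scale i t M.
Proof.
apply/matrixP => p q; rewrite !mxE (bigD1 p) //= big1 ?addr0.
  by rewrite !mxE eqxx; case: ifP; rewrite ?mulr1 ?mul1r.
by move=> s; rewrite !mxE eq_sym => /negbTE ->; case: ifP; rewrite ?mulr0 ?mul0r.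
Qed.

Lemma row_add_add i j a b M : i != j ->
  row_add i j a (row_add i j b M) = row_add i j (a + b) M.
Proof.
move=> ij; apply/matrixP => p q; rewrite !mxE (eq_sym j i) (negbTE ij).
by case: (p == i) => //=; rewrite -addrA -mulrDl [b + a]addrC.
Qed.

Lemma row_add0 i j M : row_add i j 0 M = M.
Proof. by apply/matrixP => p q; rewrite !mxE mul0r addr0; case: ifP. Qed.

Lemma row_scale_scale i s t M :
  row_scale i s (row_scale i t M) = row_scale i (s * t) M.
Proof. by apply/matrixP => p q; rewrite !mxE; case: (p == i) => //=; rewrite mulrA. Qed.

Lemma row_scale1 i M : row_scale i 1 M = M.
Proof. by apply/matrixP => p q; rewrite !mxE mul1r; case: ifP. Qed.

Lemma invertible_mx_mul M N :
  invertible_mx M -> invertible_mx N -> invertible_mx (M *m N).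
Proof.
move=> [M' [MM' M'M]] [N' [NN' N'N]]; exists (N' *m M'); split.
  by rewrite mulmxA -(mulmxA M) NN' mulmx1.
by rewrite mulmxA -(mulmxA N') M'M mulmx1.
Qed.

Lemma elem_mx_invertible i j a : i != j -> invertible_mx (elem_mx i j a).
Proof.
move=> ij; exists (elem_mx i j (- a)).
by rewrite !elem_mxM !row_add_add // subrr addNr row_add0.
Qed.

Lemma dil_mx_invertible i t t' :
  t * t' = 1 -> t' * t = 1 -> invertible_mx (dil_mx i t).
Proof.
move=> tt' t't; exists (dil_mx i t').
by rewrite !dil_mxM !row_scale_scale tt' t't row_scale1.
Qed.

(** [triv] is a class of units by which rows may be scaled.  It is a parameter
    because generation by finitely many matrices needs explicit units. *)
Variable triv : A -> Prop.
Hypothesis trivP : forall t, triv t -> exists t', [/\ triv t', t * t' = 1 & t' * t = 1].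

Inductive row_equiv : 'M[A]_n -> 'M[A]_n -> Prop :=
| row_equiv_refl M : row_equiv M M
| row_equiv_add i j a M N : i != j ->
    row_equiv (row_add i j a M) N -> row_equiv M N
| row_equiv_scale i t M N : triv t ->
    row_equiv (row_scale i t M) N -> row_equiv M N.

Lemma row_equiv_trans M N P : row_equiv M N -> row_equiv N P -> row_equiv M P.
Proof.
move=> MN; elim: MN P => {M N} // [i j a M N ij _ IH|i t M N t1 _ IH] P NP.
  exact: row_equiv_add ij (IH _ NP).
exact: row_equiv_scale t1 (IH _ NP).
Qed.

Lemma row_equiv_invertible M N :
  row_equiv M N -> invertible_mx M -> invertible_mx N.
Proof.
elim=> {M N} // [i j a M N ij _ IH|i t M N /trivP[t' [_ t1 t2]] _ IH] Mi; apply: IH.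
  by rewrite -elem_mxM; apply: invertible_mx_mul => //; apply: elem_mx_invertible.
rewrite -dil_mxM; apply: invertible_mx_mul => //.
exact: dil_mx_invertible t1 t2.
Qed.

Lemma row_equiv_comb (r : seq 'I_n) i (u : 'I_n -> A) M : i \notin r ->
  row_equiv M (\matrix_(p, q)
    (if p == i then M p q + \sum_(j <- r) u j * M j q else M p q)).
Proof.
elim: r M => [|j r IH] M.
  move=> _; rewrite (_ : \matrix_(p, q) _ = M); first exact: row_equiv_refl.
  by apply/matrixP => p q; rewrite mxE big_nil addr0; case: ifP.
rewrite in_cons negb_or => /andP[ij ir]; apply: (@row_equiv_add i j (u j) _ _ ij).
set M' := row_add _ _ _ _; rewrite (_ : \matrix_(p, q) _ = \matrix_(p, q)
    (if p == i then M' p q + \sum_(j <- r) u j * M' j q else M' p q)); first exact: IH.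
apply/matrixP => p q; rewrite !mxE; case: (p == i) => //=.
rewrite big_cons addrA; congr (_ + _); rewrite !big_seq; apply: eq_bigr => s sr.
by rewrite mxE; case: eqP => // si; rewrite -si sr in ir.
Qed.

Lemma row_equiv_clear k (r : seq 'I_n) M : uniq r -> k \notin r ->
  row_equiv M (\matrix_(p, q)
    (if p \in r then M p q - M p k * M k q else M p q)).
Proof.
elim: r M => [|i r IH] M.
  move=> _ _; rewrite (_ : \matrix_(p, q) _ = M); first exact: row_equiv_refl.
  by apply/matrixP => p q; rewrite mxE.
rewrite /= in_cons negb_or => /andP[ir ur] /andP[ki kr].
have ik : i != k by rewrite eq_sym.
apply: (@row_equiv_add i k (- M i k) _ _ ik).
set M' := row_add _ _ _ _; rewrite (_ : \matrix_(p, q) _ = \matrix_(p, q)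
    (if p \in r then M' p q - M' p k * M' k q else M' p q)); first exact: IH.
apply/matrixP => p q; rewrite !mxE in_cons (negbTE ki).
case: (eqVneq p i) => [->|pi] /=; last by case: ifP.
by rewrite (negbTE ir) mulNr.
Qed.

Hypothesis mul_eq0 : forall x y : A, x * y = 0 -> x = 0 \/ y = 0.
Hypothesis right_inv_triv : forall y v : A, y * v = 1 -> triv v.
Variable sz : A -> nat.
Hypothesis vector_reduction : forall x y : 'I_n -> A, \sum_i y i * x i = 0 ->
  (exists2 i, y i != 0 & x i != 0) ->
  exists i t (u : 'I_n -> A), [/\ triv t, x i != 0 &
    (sz (t * x i + \sum_(j | j != i) u j * x j) < sz (x i))%N].

Definition unit_columns (m : nat) M :=
  forall p q : 'I_n, (q < m)%N -> M p q = (p == q)%:R.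

Lemma left_inv_unit_columns m M N :
  N *m M = 1%:M -> unit_columns m M -> unit_columns m N.
Proof.
move=> NM Mm p q qm; have := congr1 (fun B : 'M_n => B p q) NM.
rewrite !mxE (bigD1 q) //= Mm // eqxx mulr1 big1 ?addr0 // => s sq.
by rewrite Mm // (negbTE sq) mulr0.
Qed.

Lemma unit_columns_neq (k : nat) (p q : 'I_n) M :
  unit_columns k M -> (q < k)%N -> (k <= p)%N -> M p q = 0.
Proof.
move=> Mk qk kp; rewrite Mk //; case: eqP => // pq.
by move: qk; rewrite -pq ltnNge kp.
Qed.

Lemma isolate_pivot (k : 'I_n) M i : unit_columns k M -> (k <= i)%N ->
  triv (M i k) -> (forall p : 'I_n, (k <= p)%N -> p != i -> M p k = 0) ->
  exists2 N, row_equiv M N & unit_columns k.+1 N.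
Proof.
move=> Mk ki tM Mi.
have [t' [t't _ tt']] := trivP tM.
have [N [MN Nk Nkk]] : exists N, [/\ row_equiv M N, unit_columns k N & N k k = 1].
  have [ik|ik] := eqVneq i k.
    exists (row_scale i t' M); split.
    - exact: row_equiv_scale t't (row_equiv_refl _).
    - move=> p q qk; rewrite mxE; case: eqP => [->|_]; last exact: Mk.
      by rewrite (unit_columns_neq Mk qk ki) mulr0 -(Mk i q qk) (unit_columns_neq Mk qk ki).
    - by rewrite mxE -[X in X == _]ik eqxx -tt' ik.
  exists (row_add k i t' M); split.
  - by apply: (row_equiv_add (i := k) (j := i) _ (row_equiv_refl _)); rewrite eq_sym.
  - move=> p q qk; rewrite mxE; case: eqP => [->|_]; last exact: Mk.
    by rewrite (unit_columns_neq Mk qk ki) mulr0 addr0 Mk.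
  - by rewrite mxE eqxx tt' Mi ?add0r // eq_sym.
exists (\matrix_(p, q) (if p \in rem k (enum 'I_n)
    then N p q - N p k * N k q else N p q)).
  apply: row_equiv_trans MN _; apply: row_equiv_clear.
    by rewrite rem_uniq ?enum_uniq.
  by rewrite mem_rem_uniqF ?enum_uniq.
move=> p q; rewrite mxE mem_rem_uniq ?enum_uniq // !inE mem_enum andbT ltnS leq_eqVlt.
move=> /orP[/eqP/val_inj ->|qk].
  by case: eqP => [->|_] //=; rewrite Nkk mulr1 subrr.
rewrite (unit_columns_neq Nk qk (leqnn k)) mulr0 subr0.
by case: ifP => _; apply: Nk.
Qed.

(** The rows of the inverse [N] below row [k] are relations for the entries of
    column [k] of [M] in the rows from [k] on.  If one of them is nontrivial, the
    column can be made smaller.  Otherwise column [i] of [N], where [M i k] is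
    not zero, has a single entry in the rows from [k] on, and the equation
    [M *m N = 1%:M] shows that [M i k] is a unit and the only such entry. *)
Lemma reduce_column (k : 'I_n) M : invertible_mx M -> unit_columns k M ->
  exists2 N, row_equiv M N & unit_columns k.+1 N.
Proof.
have [m] := ubnP (\sum_(p : 'I_n | (k <= p)%N) sz (M p k)).
elim: m M => // m IH M; rewrite ltnS => Mm Minv Mk.
have [N [MN NM]] := Minv; have Nk := left_inv_unit_columns NM Mk.
have NMl l : \sum_p N l p * M p k = (l == k)%:R.
  by have := congr1 (fun B : 'M_n => B l k) NM; rewrite !mxE.
have low l (F : 'I_n -> A) : (k <= l)%N ->
    \sum_(p : 'I_n | (k <= p)%N) N l p * F p = \sum_p N l p * F p.
  move=> kl; rewrite [RHS](bigID (fun p : 'I_n => (k <= p)%N)) /=.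
  rewrite [X in _ = _ + X]big1 ?addr0 // => p; rewrite -ltnNge => pk.
  by rewrite (unit_columns_neq Nk pk kl) mul0r.
have [[l [i [kl ki Nli Mik]]]|norel] := pselect (exists l i : 'I_n,
    [/\ (k < l)%N, (k <= i)%N, N l i != 0 & M i k != 0]).
  pose x (p : 'I_n) := if (k <= p)%N then M p k else 0.
  have rel : \sum_p N l p * x p = 0.
    rewrite -low ?(ltnW kl) //.
    rewrite (eq_bigr (fun p : 'I_n => N l p * M p k)) => [|p kp]; last by rewrite /x kp.
    rewrite low ?(ltnW kl) // NMl; case: eqP => // lk.
    by move: kl; rewrite lk ltnn.
  have [|i0 [t [u [tt xi0 szi0]]]] := vector_reduction rel.
    by exists i => //; rewrite /x ki.
  have ki0 : (k <= i0)%N by move: xi0; rewrite /x; case: ifP; rewrite ?eqxx.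
  pose r := [seq j <- enum 'I_n | (j != i0) && (k <= j)%N].
  have i0r : i0 \notin r by rewrite mem_filter eqxx.
  pose M1 := row_scale i0 t M.
  have M1E j q : j != i0 -> M1 j q = M j q by move=> /negbTE ji; rewrite mxE ji.
  have MM2 := row_equiv_comb u M1 i0r; set M2 := \matrix_(p, q) _ in MM2.
  have M2E p q : p != i0 -> M2 p q = M p q.
    by move=> pi; rewrite mxE (negbTE pi) M1E.
  have {}MM2 : row_equiv M M2 by apply: row_equiv_scale tt MM2.
  have M2i0 q : M2 i0 q = t * M i0 q +
      \sum_(j : 'I_n | (j != i0) && (k <= j)%N) u j * M j q.
    rewrite !mxE eqxx; congr (_ + _); rewrite big_filter big_enum_cond /=.
    by apply: eq_bigr => j /andP[ji _]; rewrite M1E.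
  have M2k : unit_columns k M2.
    move=> p q qk; have [->|pi] := eqVneq p i0; last by rewrite M2E // Mk.
    rewrite M2i0 (unit_columns_neq Mk qk ki0) mulr0 big1 ?addr0; last first.
      by move=> j /andP[_ kj]; rewrite (unit_columns_neq Mk qk kj) mulr0.
    by rewrite -(Mk i0 q qk) (unit_columns_neq Mk qk ki0).
  have [||P M2P Pk] := IH M2 _ _ M2k; last by exists P => //; apply: row_equiv_trans M2P.
    apply: leq_trans Mm; rewrite (bigD1 i0) //= [ltnRHS](bigD1 i0) //=.
    rewrite -addSn leq_add //; last first.
      by apply: leq_sum => j /andP[_ ji]; rewrite M2E.
    move: szi0; rewrite {1 3}/x ki0 M2i0; congr (sz (_ + _) < _)%N.
    rewrite [LHS](bigID (fun j : 'I_n => (k <= j)%N)) /= [X in _ + X]big1 ?addr0.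
      by apply: eq_bigr => j /andP[_ kj]; rewrite /x kj.
    by move=> j /andP[_ /negbTE kj]; rewrite /x kj mulr0.
  exact: row_equiv_invertible MM2 Minv.
have Nl0 l i : (k < l)%N -> (k <= i)%N -> M i k != 0 -> N l i = 0.
  move=> kl ki Mik; apply/eqP/negPn/negP => Nli; apply: norel.
  by exists l, i.
have [i ki Mik] : exists2 i : 'I_n, (k <= i)%N & M i k != 0.
  apply: contrapT => no; have := NMl k; rewrite eqxx -low // big1 => [/esym/eqP|p kp].
    by rewrite oner_eq0.
  have [->|Mpk] := eqVneq (M p k) 0; first by rewrite mulr0.
  by case: no; exists p.
have MNi (p : 'I_n) : (k <= p)%N -> M p k * N k i = (p == i)%:R.
  move=> kp; have := congr1 (fun B : 'M_n => B p i) MN; rewrite !mxE => <-.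
  rewrite (bigD1 k) //= big1 ?addr0 // => l lk.
  have [ll|kl|kl] := ltngtP l k; last by move: lk; rewrite (val_inj kl) eqxx.
    by rewrite (unit_columns_neq Mk ll kp) mul0r.
  by rewrite (Nl0 l i) // mulr0.
have Nki : N k i != 0.
  by apply/eqP => N0; have /esym/eqP := MNi i ki; rewrite N0 mulr0 eqxx oner_eq0.
have Mi (p : 'I_n) : (k <= p)%N -> p != i -> M p k = 0.
  move=> kp /negbTE pi; have := MNi p kp; rewrite pi => /mul_eq0[//|N0].
  by rewrite N0 eqxx in Nki.
apply: (isolate_pivot Mk ki _ Mi); apply: (@right_inv_triv (N k i)).
have := NMl k; rewrite eqxx -low // (bigD1 i) //= big1 ?addr0 //.
by move=> p /andP[kp pi]; rewrite Mi // mulr0.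
Qed.

Theorem row_equiv1 M : invertible_mx M -> row_equiv M 1%:M.
Proof.
move=> Minv.
suff key (m' : nat) : (m' <= n)%N -> exists2 N, row_equiv M N & unit_columns m' N.
  have [N MN Nn] := key n (leqnn n).
  by have <- : N = 1%:M by apply/matrixP => p q; rewrite Nn // mxE.
elim: m' => [_|m' IH mn']; first by exists M => //; apply: row_equiv_refl.
have [N MN Nm] := IH (ltnW mn').
have [P NP Pm] := @reduce_column (Ordinal mn') N (row_equiv_invertible MN Minv) Nm.
by exists P => //; apply: row_equiv_trans NP.
Qed.
End RowReduction.

(** * Generators of the general linear group *)

Section ElementaryGeneration.
Variables (n : nat) (G : groupType) (K : fieldType).
Local Notation KG := (group_algebra K G).

Definition monomial_unit (t : KG) := exists g a, a != 0 /\ t = mono g a.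

Lemma monomial_unit_inv t : monomial_unit t ->
  exists t', [/\ monomial_unit t', t * t' = 1 & t' * t = 1].
Proof.
move=> [g [a [a0 ->]]]; exists (mono g^-1%g a^-1); rewrite !monoM mulgV mulVg.
by rewrite mulfV // mulVf //; split => //; exists g^-1%g, a^-1; rewrite invr_eq0.
Qed.

Section Closed.
Variable S : {pred GL n KG}.
Hypothesis S_closed : group_closed S.

Definition mx_in (M : 'M[KG]_n) := exists2 Q : GL n KG, GL_val Q = M & Q \in S.

Lemma mx_in1 : mx_in 1%:M.
Proof. by exists 1%g => //; case: S_closed. Qed.

Lemma mx_inM M N : mx_in M -> mx_in N -> mx_in (M *m N).
Proof.
move=> [P <- PS] [Q <- QS]; exists (P * Q)%g => //.
exact: (group_closedM S_closed).
Qed.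

Lemma mx_inV M N : mx_in M -> M *m N = 1%:M -> mx_in N.
Proof.
move=> [P <- PS] PN; exists P^-1%g; last exact: (group_closedV S_closed).
by rewrite -[RHS]mul1mx -(GL_mulVmx P) -mulmxA PN mulmx1.
Qed.

Lemma dil_mx_mul i (s t : KG) : dil_mx i (s * t) = dil_mx i s *m dil_mx i t :> 'M_n.
Proof. by rewrite !dil_mxM row_scale_scale. Qed.

Lemma row_equiv_mx_in M N :
  (forall i j a, i != j -> mx_in (elem_mx i j a)) ->
  (forall i t, monomial_unit t -> mx_in (dil_mx i t)) ->
  row_equiv monomial_unit M N -> mx_in N -> mx_in M.
Proof.
move=> Sel Sdil; elim=> {M N} // [i j a M N ij _ IH|i t M N t1 _ IH] /IH MS.
  rewrite (_ : M = elem_mx i j (- a) *m row_add i j a M).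
    by apply: mx_inM => //; apply: Sel.
  by rewrite elem_mxM row_add_add // addNr row_add0.
have [t' [t'1 _ t't]] := monomial_unit_inv t1.
rewrite (_ : M = dil_mx i t' *m row_scale i t M).
  by apply: mx_inM => //; apply: Sdil.
by rewrite dil_mxM row_scale_scale t't row_scale1.
Qed.

Variable s : seq G.
Hypothesis s_gen : forall T : {pred G},
  group_closed T -> {subset s <= T} -> forall g, g \in T.
Hypothesis S_dil_s : forall i g, g \in s -> mx_in (dil_mx i (mono g 1)).
Hypothesis S_dil_K : forall i (c : K), c != 0 -> mx_in (dil_mx i (mono 1%g c)).
Hypothesis S_elem_K : forall i j (c : K), i != j -> mx_in (elem_mx i j (mono 1%g c)).

Lemma mx_in_dil_group i g : mx_in (dil_mx i (mono g 1)).
Proof.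
pose T : {pred G} := fun g => `[< forall i, mx_in (dil_mx i (mono g 1)) >].
suff : g \in T by move=> /asboolP.
apply: s_gen => [|h hs]; last by apply/asboolP => j; apply: S_dil_s.
split=> [|x y /asboolP Tx /asboolP Ty]; apply/asboolP => j.
  by rewrite /dil_mx row_scale1; apply: mx_in1.
rewrite -[1]mulr1 -monoM dil_mx_mul; apply: mx_inM => //.
apply: mx_inV (Ty j) _.
by rewrite -dil_mx_mul monoM mulgV mulr1 /dil_mx row_scale1.
Qed.

Lemma mx_in_dil i t : monomial_unit t -> mx_in (dil_mx i t).
Proof.
move=> [g [a [a0 ->]]].
rewrite -[a]mul1r -[g]mulg1 -monoM dil_mx_mul.
by apply: mx_inM; [apply: mx_in_dil_group | apply: S_dil_K].
Qed.

(** Additivity of the entry reduces to monomials, and conjugation by a diagonal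
    matrix turns an entry in [K] into a monomial. *)
Lemma mx_in_elem i j (a : KG) : i != j -> mx_in (elem_mx i j a).
Proof.
move=> ij; rewrite (ga_expand a).
apply: (big_ind (fun a => mx_in (elem_mx i j a))) => [|x y xS yS|g _].
- by rewrite /elem_mx row_add0; apply: mx_in1.
- rewrite (_ : elem_mx i j (x + y) = elem_mx i j x *m elem_mx i j y).
    exact: mx_inM.
  by rewrite elem_mxM row_add_add.
set c := mcoeff g a.
rewrite (_ : elem_mx i j _ = dil_mx i (mono g 1) *m
    (elem_mx i j (mono 1%g c) *m dil_mx i (mono g^-1%g 1))).
  by apply: mx_inM (mx_inM _ _); try exact: mx_in_dil_group; apply: S_elem_K.
rewrite elem_mxM dil_mxM; apply/matrixP => p q; rewrite !mxE.
rewrite (eq_sym j i) (negbTE ij); case: (p == i) => //=.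
by rewrite mulrDr !mulrA !monoM mulg1 mulgV !mul1r.
Qed.
End Closed.
End ElementaryGeneration.

Theorem theorem5 (n : nat) (hn : (1 <= n)%N)
    (G : groupType)
    (R : realType) (H : metricType R) (hH : hyperbolic_space 1 H)
    (act : G -> H -> H) (hact : isometric_action act)
    (hdisp : ((100 * log2 (n.+1`!)%:R)%:E < minimal_displacement act)%E)
    (K : finFieldType)
    (hG : finitely_generated G) :
  finitely_generated (GL n (group_algebra K G)).
Proof.
have [_ [[p0] _ _ _]] := hH.
have [k [k2 kn nk]] := exists_dyadic_bound hn.
have budget := le_log2_fact R hn k2 kn.
set D := 100 * _ in hdisp budget.
have displ g p : g != 1%g -> D < mdist (act g p) p.
  move=> g1; rewrite -lte_fin; apply: lt_le_trans hdisp _.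
  by apply: ereal_inf_lbound; exists g => //; exists p.
(* The diameter drops by at least 2 at every reduction, hence its half has an
   integral part that drops; 0 is kept for the zero element. *)
pose sz (x : group_algebra K G) :=
  if x == 0 then 0%N else (Num.truncn (diam act p0 x / 2)).+1.
have reduction (x y : 'I_n -> group_algebra K G) : \sum_i y i * x i = 0 ->
    (exists2 i, y i != 0 & x i != 0) ->
    exists i (t : group_algebra K G) (u : 'I_n -> group_algebra K G),
      [/\ monomial_unit t, x i != 0 &
      (sz (t * x i + \sum_(j | j != i) u j * x j)%R < sz (x i))%N].
  move=> yx yx0.
  have [i [g [a [u [a0 xi0 xd]]]]] := vector_reduction hact hH p0 nk budget displ yx yx0.
  exists i, (mono g a), u; split => //; first by exists g, a.
  move: xd => /=; set x' := _ + _; rewrite /sz (negbTE xi0).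
  have [->|x'0 [/eqP|xd]] := eqVneq x' 0; rewrite ?eqxx ?(negbTE x'0) //.
  have d0 : 0 <= diam act p0 x' by apply/bigmax_geP; left.
  rewrite ltnS truncn_ge_nat -?[X in X <= _]natr1; last lra.
  have /truncn_itv/andP[+ _] : 0 <= diam act p0 x' / 2 by lra.
  lra.
have [s s_gen] := hG.
pose toGL (M : 'M[group_algebra K G]_n) : GL n (group_algebra K G) :=
  if pselect (invertible_mx M) is left iM then MkGL (asboolT iM) else 1%g.
pose units_K := [seq c <- enum K | c != 0].
pose mats : seq 'M[group_algebra K G]_n :=
  [seq dil_mx i (mono g 1) | i <- enum 'I_n, g <- s] ++
  [seq dil_mx i (mono 1%g c) | i <- enum 'I_n, c <- units_K] ++
  [seq elem_mx ij.1 ij.2 (mono 1%g c) |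
     ij <- [seq ij <- enum {: 'I_n * 'I_n} | ij.1 != ij.2], c <- enum K].
exists (map toGL mats) => S S_closed S_gen Q.
have mats_in M : invertible_mx M -> M \in mats -> mx_in S M.
  move=> iM Mm; exists (toGL M); last by apply: S_gen; apply: map_f.
  by rewrite /toGL; case: pselect.
have dil_inv i (t : group_algebra K G) : monomial_unit t -> invertible_mx (dil_mx i t).
  move=> /monomial_unit_inv[t' [_ tt' t't]].
  exact: dil_mx_invertible tt' t't.
have S_dil_s i g : g \in s -> mx_in S (dil_mx i (mono g 1)).
  move=> gs; apply: mats_in.
    by apply: dil_inv; exists g, 1; rewrite oner_neq0.
  rewrite mem_cat; apply/orP; left.
  by apply/allpairsP; exists (i, g); rewrite mem_enum.
have S_dil_K i (c : K) : c != 0 -> mx_in S (dil_mx i (mono 1%g c)).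
  move=> c0; apply: mats_in; first by apply: dil_inv; exists 1%g, c.
  rewrite !mem_cat; apply/orP; right; apply/orP; left.
  have cK : c \in units_K by rewrite mem_filter /= c0 mem_enum.
  by apply/allpairsP; exists (i, c); rewrite mem_enum.
have S_elem_K i j (c : K) : i != j -> mx_in S (elem_mx i j (mono 1%g c)).
  move=> ij; apply: mats_in; first exact: elem_mx_invertible.
  rewrite !mem_cat; apply/orP; right; apply/orP; right.
  by apply/allpairsP; exists ((i, j), c); rewrite /= mem_filter /= ij !mem_enum.
have : mx_in S (GL_val Q).
  apply: (row_equiv_mx_in S_closed _ _ _ (mx_in1 S_closed)).
  - by move=> i j a ij; apply: (mx_in_elem S_closed s_gen).
  - by move=> i t t1; apply: (mx_in_dil S_closed s_gen).
  - apply: (row_equiv1 (@monomial_unit_inv G K) _ _ reduction (GL_invertible Q)).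
      exact: (ga_mul_eq0 hact hH p0 hn nk budget displ).
    by move=> y v /(right_inv_mono hact hH p0 hn nk budget displ).
by move=> [P /val_inj <-].
Qed.
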